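(* Let $n$ be a positive integer, let $p$ be a prime number with $p\mid n$, let $\mathbb{Z}_n=\langle x\rangle$ be the cyclic group of order $n$ (written multiplicatively), and let $S\subseteq\mathbb{Z}_n\setminus\{e\}$ be inverse-closed, where $e$ is the identity. Let $a,b$ be nonnegative integers and let $C$ be an $(a,b)$-regular set in $\mathrm{Cay}(\mathbb{Z}_n,S)$. Put $s_0:=|\langle x^p\rangle\cap S|+b-a$ and $s_d:=|x^d\langle x^p\rangle\cap S|$ for each integer $d\in[1,p-1]$. If $\sum_{d=0}^{p-1}s_d\neq 0$ and there exist integers $0\le u,v\le p-1$ such that $s_u\neq s_v$, then $p\mid |C|$ and $|x^h\langle x^p\rangle\cap C|=\frac{|C|}{p}$ for all $0\le h\le p-1$.
   Context: For a finite group $G$ with identity $e$ and an inverse-closed subset $S\subseteq G\setminus\{e\}$, the Cayley graph $\mathrm{Cay}(G,S)$ is the simple graph with vertex set $G$ in which $y$ and $z$ are adjacent if and only if $y^{-1}z\in S$. For a graph $\Gamma$ and nonnegative integers $a,b$, a nonempty proper subset $C$ of $V(\Gamma)$ is an $(a,b)$-regular set of $\Gamma$ if every vertex in $C$ has exactly $a$ neighbours in $C$ and every vertex in $V(\Gamma)\setminus C$ has exactly $b$ neighbours in $C$. *)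

(* Defs.v *)
From HB Require Import structures.
From mathcomp Require Import all_boot all_order all_algebra all_fingroup all_solvable.

Set Implicit Arguments.
Unset Strict Implicit.
Unset Printing Implicit Defensive.

Local Open Scope group_scope.

(* Edge relation on the vertex set gT.  It is a simple graph when S is
   inverse-closed and avoids 1; see cayley_sym and cayley_irrefl. *)
Definition cayley (gT : finGroupType) (S : {set gT}) : rel gT :=
  fun y z => y^-1 * z \in S.

Definition inverse_closed (gT : finGroupType) (S : {set gT}) : Prop :=
  forall s, s \in S -> s^-1 \in S.

Lemma cayley_sym (gT : finGroupType) (S : {set gT}) :
  inverse_closed S -> symmetric (cayley S).
Proof.
move=> SV y z; rewrite /cayley; apply/idP/idP => /SV.
  by rewrite invMg invgK.
by rewrite invMg invgK.
Qed.

Lemma cayley_irrefl (gT : finGroupType) (S : {set gT}) :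
  1 \notin S -> irreflexive (cayley S).
Proof. by move=> S1 y; rewrite /cayley mulVg (negbTE S1). Qed.

Definition regular_set (T : finType) (e : rel T) (a b : nat) (C : {set T}) :
    Prop :=
  [/\ C != set0,
      C \proper [set: T],
      forall v, v \in C -> #|[set w in C | e v w]| = a
    & forall v, v \notin C -> #|[set w in C | e v w]| = b].

(* Integer-valued because the value at d = 0 can be negative. *)
Definition coset_count (gT : finGroupType) (x : gT) (p : nat) (S : {set gT})
    (a b d : nat) : int :=
  if d == 0%N then (Posz #|(<[x ^+ p]> :&: S)%g| + Posz b - Posz a)%R
  else Posz #|(x ^+ d *: <[x ^+ p]>) :&: S|.

(* Main.v *)
Require Import Defs.
From mathcomp Require Import all_boot all_order all_algebra all_fingroup all_solvable.
From mathcomp Require Import all_field.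

(** Let [z] be a primitive [p]-th root of unity and let [psi] be the character
of the cyclic group sending [x ^+ i] to [z ^+ i]; it exists because [p] divides
the order of [x].  Write [psi(A)] for the sum of [psi] over a set [A].
Counting the pairs (v, w) with [w] in [C] and [v], [w] adjacent, each weighted
by [psi v], in two ways turns (a,b)-regularity into
[psi(C) * psi(S) = a * psi(C) + b * (psi(G) - psi(C))].  As [psi] is
nontrivial, [psi(G) = 0], whence [psi(C) * (psi(S) + b - a) = 0]
([regular_set_char]).

The character [psi] is constant on the cosets of [<[x ^+ p]>], so that both
factors are integer combinations of [1, z, ..., z ^+ p.-1] ([sum_char_cosets]):
the coefficients are the numbers [#|x ^+ h *: <[x ^+ p]> :&: C|] for the first
one and the numbers [s_d] for the second.  The minimal polynomial of [z] has
degree [p - 1], so such a combination vanishes only if its coefficients are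
all equal ([prim_root_relation]).  The [s_d] are not all equal, so the second
factor is nonzero, the first one vanishes, and [C] meets all the cosets in the
same number of elements. *)

Set Implicit Arguments.
Unset Strict Implicit.
Unset Printing Implicit Defensive.

Import Order.TTheory GRing.Theory Num.Theory.
Local Open Scope ring_scope.

(** * Integer relations between the powers of a root of unity of prime order *)

Lemma sum_prim_root_eq0 (R : idomainType) (n : nat) (z : R) :
  (1 < n)%N -> n.-primitive_root z -> \sum_(i < n) z ^+ i = 0.
Proof.
move=> n_gt1 prim_z; apply/eqP.
have z_neq1 : z - 1 != 0.
  rewrite subr_eq0; apply/eqP => z1; move: n_gt1.
  by rewrite ltnNge dvdn_leq // (prim_order_dvd prim_z) z1 expr1n eqxx.
have /eqP := subrX1 z n; rewrite (prim_expr_order prim_z) subrr eq_sym.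
by rewrite mulf_eq0 (negbTE z_neq1).
Qed.

(** Subtracting [f p.-1] times the relation [1 + z + ... + z ^+ p.-1 = 0] kills
the coefficient of [z ^+ p.-1]; what is left is a rational polynomial of degree
less than [p - 1], the degree of the minimal polynomial of [z], that vanishes
at [z]. *)
Lemma prim_root_relation (p : nat) (z : algC) (f : nat -> int) :
  prime p -> p.-primitive_root z ->
  \sum_(i < p) (f i)%:~R * z ^+ i = 0 ->
  forall i, (i < p)%N -> f i = f p.-1.
Proof.
move=> p_pr prim_z rel_f.
have [m [Dm _ m_dvd]] := minCpolyP z.
have size_m : size m = p.
  rewrite -(size_map_poly (ratr : {rmorphism rat -> algC})) -Dm.
  rewrite (minCpoly_cyclotomic prim_z) size_cyclotomic totient_prime //.
  by rewrite prednK ?prime_gt0.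
pose q : {poly rat} := \poly_(i < p.-1) (f i - f p.-1)%:~R.
have q0 : q = 0.
  apply/eqP; apply/negPn/negP => q_neq0.
  have /(dvdp_leq q_neq0) : m %| q.
    rewrite -m_dvd /root; apply/eqP.
    rewrite (horner_coef_wide _ (n := p)); last first.
      by rewrite size_map_poly (leq_trans (size_poly _ _)) ?leq_pred.
    have -> : \sum_(i < p) (map_poly ratr q)`_i * z ^+ i
        = \sum_(i < p) ((f i)%:~R * z ^+ i - (f p.-1)%:~R * z ^+ i).
      apply: eq_bigr => i _; rewrite coef_map coef_poly /= -mulrBl -rmorphB /=.
      case: ltnP => [_ | le_i]; first by rewrite ratr_int.
      have -> : i = p.-1 :> nat.
        by apply/eqP; rewrite eqn_leq le_i -ltnS prednK ?prime_gt0 ?ltn_ord.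
      by rewrite subrr rmorph0.
    by rewrite sumrB rel_f -mulr_sumr (sum_prim_root_eq0 _ prim_z)
               ?prime_gt1 // mulr0 subr0.
  rewrite size_m leqNgt => /negP[].
  by rewrite (leq_ltn_trans (size_poly _ _)) // prednK ?prime_gt0.
move=> i lt_ip; have [lt_ip1 | le_p1i] := ltnP i p.-1; last first.
  congr f; apply/eqP.
  by rewrite eqn_leq le_p1i -ltnS prednK ?prime_gt0 // lt_ip.
have /eqP := congr1 (fun r : {poly rat} => r`_i) q0.
by rewrite coef_poly lt_ip1 coef0 intr_eq0 subr_eq0 => /eqP.
Qed.

(** * Regular sets and multiplicative functions *)

(** Sum [psi v] over the pairs (v, w) with [w] in [C] adjacent to [v].  For
fixed [v] regularity gives the number of [w], and the values of [psi] outside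
[C] add up to [- psi(C)], so the sum is [psi(C) * (a - b)]; for fixed [w] the
vertices [v] are the products [w * s] with [s] in [S], so the sum is
[psi(C) * psi(S)]. *)
Lemma regular_set_char (R : pzRingType) (gT : finGroupType)
    (S C : {set gT}) (a b : nat) (psi : gT -> R) :
  inverse_closed S -> regular_set (cayley S) a b C ->
  {morph psi : g h / (g * h)%g >-> g * h} -> \sum_g psi g = 0 ->
  (\sum_(g in C) psi g) * (\sum_(g in S) psi g + b%:R - a%:R) = 0.
Proof.
move=> S_inv [_ _ Ca Cb] psiM psi0.
set psiC := \sum_(g in C) psi g.
have psiC' : \sum_(g | g \notin C) psi g = - psiC.
  have := psi0; rewrite (bigID (mem C)) /= => /eqP.
  by rewrite addrC addr_eq0 => /eqP.
have cayleyV : symmetric (cayley S) := cayley_sym S_inv.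
have count_v : \sum_v \sum_(w in C | cayley S v w) psi v
             = psiC * a%:R - psiC * b%:R.
  rewrite (bigID (mem C)) /= -mulNr -psiC' !mulr_suml; congr (_ + _).
    apply: eq_bigr => v vC; rewrite sumr_const -(Ca v vC) mulr_natr.
    by congr (_ *+ _); apply: eq_card => w; rewrite inE.
  apply: eq_bigr => v vC; rewrite sumr_const -(Cb v vC) mulr_natr.
  by congr (_ *+ _); apply: eq_card => w; rewrite inE.
have count_w : \sum_v \sum_(w in C | cayley S v w) psi v
             = psiC * \sum_(g in S) psi g.
  rewrite (exchange_big_dep (mem C)) /=; last by move=> v w _ /andP[].
  rewrite mulr_suml; apply: eq_bigr => w wC.
  rewrite (reindex_inj (mulgI w)) mulr_sumr; apply: eq_big => [s | s _].
    by rewrite wC cayleyV /cayley mulKg.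
  by rewrite psiM.
by rewrite mulrBr mulrDr -count_w count_v subrK subrr.
Qed.

(** * Characters of a cyclic group *)

Section CyclicCharacter.

Variables (gT : finGroupType) (x : gT).
Hypothesis x_gen : [set: gT] = <[x]>%g.

Definition dlog (g : gT) : nat :=
  oapp (fun i : 'I_#[x]%g => val i) 0%N [pick i : 'I_#[x]%g | (x ^+ i)%g == g].

Lemma expg_dlog (g : gT) : (x ^+ dlog g)%g = g.
Proof.
rewrite /dlog; case: pickP => [i /eqP-> // | no_i] /=.
have : g \in <[x]>%g by rewrite -x_gen inE.
by case/cyclePmin => m lt_m Dg; case/eqP: (no_i (Ordinal lt_m)).
Qed.

Variables (p : nat) (z : algC).
Hypotheses (p_dvd_x : (p %| #[x]%g)%N) (prim_z : p.-primitive_root z).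

Definition cyclic_char (g : gT) : algC := z ^+ dlog g.

(** The logarithm is defined modulo [#[x]], hence modulo [p]. *)
Lemma dlogX_mod (i : nat) : dlog (x ^+ i)%g = i %[mod p].
Proof.
apply/eqP; rewrite -(modn_dvdm (dlog _) p_dvd_x) -(modn_dvdm i p_dvd_x).
by move/eqP: (expg_dlog (x ^+ i)%g); rewrite eq_expg_mod_order => /eqP->.
Qed.

Lemma cyclic_charX (i : nat) : cyclic_char (x ^+ i)%g = z ^+ i.
Proof. by apply/eqP; rewrite (eq_prim_root_expr prim_z) dlogX_mod. Qed.

Lemma cyclic_charM : {morph cyclic_char : g h / (g * h)%g >-> g * h}.
Proof.
by move=> g h; rewrite -[in LHS](expg_dlog g) -[in LHS](expg_dlog h) -expgD
                       cyclic_charX exprD.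
Qed.

(** Translating the sum by [x] multiplies it by [z], which is not [1]. *)
Lemma sum_cyclic_char : (1 < p)%N -> \sum_g cyclic_char g = 0.
Proof.
move=> p_gt1; apply/eqP.
have : (z - 1) * \sum_g cyclic_char g == 0.
  rewrite mulrBl mul1r subr_eq0 eq_sym {1}(reindex_inj (mulgI x)) mulr_sumr /=.
  by apply/eqP/eq_bigr => g _; rewrite cyclic_charM -{1}(expg1 x) cyclic_charX.
rewrite mulf_eq0 subr_eq0 -(expr0 z) -{1}(expr1 z) (eq_prim_root_expr prim_z).
by rewrite !modn_small // ltnW.
Qed.

Lemma mem_lcoset_cycleX (h : nat) (g : gT) :
  (h < p)%N -> (g \in x ^+ h *: <[x ^+ p]>)%g = (dlog g %% p == h)%N.
Proof.
move=> lt_hp; apply/idP/eqP => [/lcosetP[_ /cycleP[k ->] ->] | Dh].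
  by rewrite -expgM -expgD dlogX_mod addnC mulnC modnMDl modn_small.
apply/lcosetP; exists ((x ^+ p) ^+ (dlog g %/ p))%g; first exact: mem_cycle.
by rewrite -{1}(expg_dlog g) {1}(divn_eq (dlog g) p) Dh addnC expgD mulnC expgM.
Qed.

Let p_gt0 : (0 < p)%N := prim_order_gt0 prim_z.

(** The cosets of [<[x ^+ p]>] partition the group. *)
Lemma sum_lcosets (R : nmodType) (A : {set gT}) (F : gT -> R) :
  \sum_(g in A) F g
    = \sum_(h < p) \sum_(g in (x ^+ h *: <[x ^+ p]> :&: A)%g) F g.
Proof.
rewrite (partition_big (fun g => Ordinal (ltn_pmod (dlog g) p_gt0)) predT) //=.
by apply: eq_bigr => h _; apply: eq_bigl => g;
   rewrite inE mem_lcoset_cycleX // andbC -val_eqE.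
Qed.

Lemma card_lcosets (A : {set gT}) :
  #|A| = (\sum_(h < p) #|(x ^+ h *: <[x ^+ p]> :&: A)%g|)%N.
Proof.
by rewrite -sum1_card sum_lcosets; apply: eq_bigr => h _; rewrite sum1_card.
Qed.

Lemma sum_char_cosets (A : {set gT}) :
  \sum_(g in A) cyclic_char g
    = \sum_(h < p) #|(x ^+ h *: <[x ^+ p]> :&: A)%g|%:R * z ^+ h.
Proof.
rewrite sum_lcosets; apply: eq_bigr => h _.
rewrite mulr_natl -sumr_const; apply: eq_bigr => g.
rewrite inE mem_lcoset_cycleX // => /andP[/eqP Dh _].
by apply/eqP; rewrite (eq_prim_root_expr prim_z) Dh modn_small.
Qed.

(** The correction [b - a] in [s_0] is the coefficient that [b - a] contributes
at [z ^+ 0]. *)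
Lemma sum_coset_count (S : {set gT}) (a b : nat) :
  \sum_(d < p) (coset_count x p S a b d)%:~R * z ^+ d
    = \sum_(g in S) cyclic_char g + b%:R - a%:R.
Proof.
rewrite sum_char_cosets !(bigD1 (Ordinal p_gt0) isT) /= expr0 !mulr1.
rewrite expg0 lcoset1 /coset_count eqxx rmorphB rmorphD /= -!pmulrn.
have tailE : \sum_(d < p | d != Ordinal p_gt0)
      (coset_count x p S a b d)%:~R * z ^+ d
    = \sum_(d < p | d != Ordinal p_gt0)
      #|(x ^+ d *: <[x ^+ p]> :&: S)%g|%:R * z ^+ d.
  by apply: eq_bigr => d d_neq0; rewrite /coset_count ifN.
by rewrite tailE [LHS]addrAC; congr (_ - _); exact: addrAC.
Qed.

End CyclicCharacter.

Theorem theorem2p9 (n p : nat) (n_gt0 : (0 < n)%N) (p_prime : prime p)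
    (p_dvd_n : (p %| n)%N)
    (gT : finGroupType) (x : gT)
    (gT_cyclic : [set: gT] = <[x]>%g) (order_x : #[x]%g = n)
    (S : {set gT}) (S_not1 : 1%g \notin S) (S_inv : inverse_closed S)
    (a b : nat) (C : {set gT}) (C_regular : regular_set (cayley S) a b C)
    (sum_neq0 : (\sum_(0 <= d < p) coset_count x p S a b d)%R <> 0%R)
    (s_nonconst : exists u v : nat,
       [/\ (u <= p - 1)%N, (v <= p - 1)%N
         & coset_count x p S a b u <> coset_count x p S a b v]) :
  (p %| #|C|)%N /\
  (forall h : nat, (h <= p - 1)%N ->
     #|(x ^+ h *: <[x ^+ p]> :&: C)%g| = (#|C| %/ p)%N).
Proof.
have p_gt0 := prime_gt0 p_prime.
have lt_p (i : nat) : (i <= p - 1)%N -> (i < p)%N.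
  by rewrite subn1 -ltnS prednK.
have [z prim_z] := C_prim_root_exists p_gt0.
have p_dvd_x : (p %| #[x]%g)%N by rewrite order_x.
pose psi := cyclic_char x z.
have psiM : {morph psi : g h / (g * h)%g >-> g * h}.
  exact: (cyclic_charM gT_cyclic p_dvd_x prim_z).
have psiG : \sum_g psi g = 0.
  exact: (sum_cyclic_char gT_cyclic p_dvd_x prim_z (prime_gt1 p_prime)).
have /eqP := regular_set_char S_inv C_regular psiM psiG.
rewrite -(sum_coset_count gT_cyclic p_dvd_x prim_z) mulf_eq0.
case/orP=> /eqP; last first.
  move/(prim_root_relation p_prime prim_z) => s_const.
  by case: s_nonconst => u [v [/lt_p lt_u /lt_p lt_v []]]; rewrite !s_const.
pose c h := #|(x ^+ h *: <[x ^+ p]> :&: C)%g|.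
rewrite (sum_char_cosets gT_cyclic p_dvd_x prim_z).
move/(prim_root_relation (f := fun h => Posz (c h)) p_prime prim_z) => c_const.
have card_C : #|C| = (p * c p.-1)%N.
  rewrite (card_lcosets gT_cyclic p_dvd_x prim_z).
  rewrite (eq_bigr (fun=> c p.-1)) => [|h _]; last first.
    by case: (c_const h (ltn_ord h)).
  by rewrite sum_nat_const card_ord.
split=> [|h /lt_p lt_h]; first by rewrite card_C dvdn_mulr.
by rewrite card_C mulKn //; case: (c_const h lt_h).
Qed.
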